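(* Let $H$ be a real Hilbert space, let $X$ be a nonempty closed convex subset of $H$, and let $F : X \to H$ be continuous on $X$ and pseudomonotone$^+$ on $X$. Let $X^*$ be the solution set of the variational inequality problem for $(F,X)$ and assume that $X^*$ is nonempty. Then $X^*$ is weakly sharp if and only if there exists a constant $\alpha>0$ such that $$\langle F(P_{X^*}(x)),\, x - P_{X^*}(x)\rangle \ge \alpha \,\mathrm{dist}(x,X^* )\quad\text{for all } x\in X.$$
   Context: $H$ is a real Hilbert space with inner product $\langle\cdot,\cdot\rangle$ and norm $\|\cdot\|$. The solution set is $X^*=\{x^*\in X : \langle F(x^* ),x-x^*\rangle\ge 0 \text{ for all } x\in X\}$. $F$ is pseudomonotone on $X$ if for all $x,y\in X$, $\langle F(x),y-x\rangle\ge 0$ implies $\langle F(y),y-x\rangle\ge 0$. $F$ is pseudomonotone$^+$ on $X$ if it is pseudomonotone on $X$ and for all $x,y\in X$, $\langle F(x),y-x\rangle\ge 0$ and $\langle F(y),y-x\rangle=0$ imply $F(x)=F(y)$. (Under the hypotheses $X^*$ is closed and convex.) $\mathrm{dist}(x,C)=\inf_{y\in C}\|y-x\|$, and $P_C(x)$ is the unique point of a nonempty closed convex set $C$ nearest to $x$. The polar of $C\subseteq H$ is $C^\circ=\{u\in H:\langle u,x\rangle\le 0\ \text{for all } x\in C\}$. For a closed convex set $C$ and $x\in C$, the tangent cone is $T_C(x)=\mathrm{cl}\big(\bigcup_{\lambda>0}\frac{C-x}{\lambda}\big)$ and the normal cone is $N_C(x)=[T_C(x)]^\circ=\{u\in H:\langle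 u,y-x\rangle\le 0\ \text{for all } y\in C\}$. $X^*$ is called weakly sharp if $-F(x^* )\in\mathrm{int}\Big(\bigcap_{x\in X^*}\big[T_X(x)\cap N_{X^*}(x)\big]^\circ\Big)$ for all $x^*\in X^*$. *)

(* Defs.v *)
From HB Require Import structures.
From mathcomp Require Export all_boot all_order all_algebra.
From mathcomp Require Export sesquilinear.
From mathcomp Require Export all_classical all_reals all_analysis.

Set Implicit Arguments.
Unset Strict Implicit.
Unset Printing Implicit Defensive.

Export Order.TTheory GRing.Theory Num.Theory.
Export numFieldNormedType.Exports.

Global Open Scope classical_set_scope.
Global Open Scope ring_scope.

(* A real Hilbert space is a complete normed module [H] over [R : realType]
   together with a symmetric positive definite bilinear form
   [ip : {dot H for idfun}] that induces the norm of [H]. *)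
Definition induces_norm (R : realType) (H : normedModType R)
    (ip : {dot H for @idfun R}) : Prop :=
  forall x : H, ip x x = `|x| ^+ 2.

Section VariationalInequality.
Variables (R : realType) (H : normedModType R) (ip : {dot H for @idfun R}).
Implicit Types (X C : set H) (F : H -> H) (x : H).

(* A mapping X -> H is a total [F : H -> H] whose values outside [X] are never
   used. *)
Definition vi_solutions X F : set H :=
  [set xs | X xs /\ forall x, X x -> 0 <= ip (F xs) (x - xs)].

Definition pseudomonotone X F : Prop :=
  forall x y, X x -> X y -> 0 <= ip (F x) (y - x) -> 0 <= ip (F y) (y - x).

Definition pseudomonotone_plus X F : Prop :=
  pseudomonotone X F /\
  forall x y, X x -> X y ->
    0 <= ip (F x) (y - x) -> ip (F y) (y - x) = 0 -> F x = F y.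

Definition dist x C : R := inf [set `|y - x| | y in C].

(* The nearest point exists and is unique when [C] is nonempty, closed and
   convex and [H] is Hilbert; the default value 0 is taken when there is no
   nearest point. *)
Definition proj C x : H :=
  xget 0 [set p | C p /\ forall y, C y -> `|p - x| <= `|y - x|].

Definition polar C : set H := [set u | forall x, C x -> ip u x <= 0].

Definition tangent_cone C x : set H :=
  closure (\bigcup_(l in [set l : R | 0 < l]) [set l^-1 *: (y - x) | y in C]).

Definition normal_cone C x : set H := polar (tangent_cone C x).

Definition weakly_sharp X F : Prop :=
  let Xs := vi_solutions X F in
  forall xs, Xs xs ->
    interior (\bigcap_(x in Xs) polar (tangent_cone X x `&` normal_cone Xs x))
      (- F xs).

End VariationalInequality.

(* Main.v *)
Require Import Defs.
From mathcomp Require Import ring lra.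

Set Implicit Arguments.
Unset Strict Implicit.
Unset Printing Implicit Defensive.

(** Write X* for the solution set, P for the nearest point projection onto X*
    and T, N for tangent and normal cones.

    Two facts about X* carry the proof. By Minty's lemma ([minty]) X* is the
    intersection of X with closed half-spaces, one for each point of X; so it is
    closed and convex, and P is well defined. By pseudomonotonicity+ the map F
    takes a single value c on X* ([vi_solutions_value_unique]). Weak sharpness
    thus speaks of the one vector - c, and it says that a ball of some radius r
    around - c lies in the polar of T_X(x) `&` N_{X*}(x) for all x in X*.

    If such a ball exists, take x in X and p = P x. Then d = x - p is tangent to
    X at p, since X contains x, and normal to X* at p, since p is a nearest point
    ([nearest_point_ip_le]). Testing the polar condition on d with the vector of
    the ball that is displaced from - c by r / 2 in the direction of d gives
    r / 2 * |d| <= <c, d>.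

    Conversely, the inequality with constant alpha implies
    alpha * |v| <= <c, v> for all v in T_X(x) `&` N_{X*}(x)
    ([tangent_normal_ip_ge]); by Cauchy-Schwarz, the ball of radius alpha around
    - c then lies in the polar. *)

(** * Real inner products *)

Section InnerProduct.
Context (R : realType) (H : normedModType R) (ip : {dot H for @idfun R}).
Context (hip : induces_norm ip).
Implicit Types (u v w x y z : H) (C : set H).

Lemma ipC u v : ip u v = ip v u.
Proof. by have /= := hermC ip u v; rewrite expr0 mul1r. Qed.

Lemma sqr_normD u v : `|u + v| ^+ 2 = `|u| ^+ 2 + 2 * ip u v + `|v| ^+ 2.
Proof.
by rewrite -!hip linearDl !linearDr /= [ip v u]ipC; ring.
Qed.

Lemma sqr_normB u v : `|u - v| ^+ 2 = `|u| ^+ 2 - 2 * ip u v + `|v| ^+ 2.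
Proof. by rewrite sqr_normD /= linearNr normrN mulrN. Qed.

(** The triangle inequality for an induced norm, squared, is Cauchy-Schwarz. *)
Lemma ip_le_norm u v : ip u v <= `|u| * `|v|.
Proof.
have : `|u + v| ^+ 2 <= (`|u| + `|v|) ^+ 2.
  by rewrite ler_sqr ?nnegrE ?addr_ge0 // ler_normD.
by rewrite sqr_normD; nra.
Qed.

(** Polarization expresses the form through the norm, which is continuous. *)
Lemma ip_continuous u : continuous (ip u).
Proof.
have -> : ip u = fun v => 2^-1 * (`|u + v| * `|u + v| - `|u| ^+ 2 - `|v| * `|v|).
  by apply/funext => v; rewrite -!expr2 sqr_normD; field.
move=> v; apply: cvgMr; apply: cvgB; last first.
  by apply: cvgM; exact: norm_continuous.
apply: cvgB; last exact: cvg_cst.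
have cvD : `|u + w| @[w --> v] --> `|u + v|.
  by apply: cvg_norm; apply: cvgD; [exact: cvg_cst | exact: cvg_id].
exact: cvgM.
Qed.

Lemma closed_ip_le u (c : R) : closed [set v | ip u v <= c].
Proof.
apply: (@preimage_closed _ _ (ip u) [set r | r <= c]); last exact: closed_le.
by move=> v _; exact: ip_continuous.
Qed.

Lemma closed_ip_ge u (c : R) : closed [set v | c <= ip u v].
Proof.
apply: (@preimage_closed _ _ (ip u) [set r | c <= r]); last exact: closed_ge.
by move=> v _; exact: ip_continuous.
Qed.

Lemma convex_segment C x y (t : R) : convex_set C -> C x -> C y ->
  0 <= t -> t <= 1 -> C (x + t *: (y - x)).
Proof.
move=> Cc Cx Cy t0 t1.
suff <- : t *: y + (1 - t) *: x = x + t *: (y - x).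
  exact/set_mem/(Cc y x (Itv01 t0 t1) (mem_set Cy) (mem_set Cx)).
by rewrite scalerBl scale1r scalerBr addrCA.
Qed.

(** Moving from [p] towards [z] by a step [t] cannot decrease the distance to
    [x], so 2 <x - p, z - p> <= t |z - p|^2 for 0 < t <= 1;
    a positive left-hand side is contradicted by taking [t] small. *)
Lemma nearest_point_ip_le C x p z : convex_set C -> C p ->
  (forall y, C y -> `|p - x| <= `|y - x|) -> C z -> ip (x - p) (z - p) <= 0.
Proof.
move=> Cc Cp pmin Cz; set g := ip _ _; set q := `|z - p| ^+ 2.
have q0 : 0 <= q by exact: sqr_ge0.
have step t : 0 < t -> t <= 1 -> 2 * g <= t * q.
  move=> t0 t1.
  have : `|x - p| ^+ 2 <= `|p + t *: (z - p) - x| ^+ 2.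
    rewrite ler_sqr ?nnegrE // distrC.
    exact/pmin/(convex_segment Cc Cp Cz (ltW t0)).
  have -> : p + t *: (z - p) - x = t *: (z - p) - (x - p).
    by rewrite opprB addrA [p + _]addrC.
  rewrite [leRHS]sqr_normB linearZl_LR /= [ip _ (x - p)]ipC -/g normrZ exprMn -/q.
  rewrite (ger0_norm (ltW t0)) => le_sq.
  have : 0 <= t * (t * q - 2 * g) by lra.
  by rewrite pmulr_rge0 // subr_ge0.
rewrite leNgt; apply/negP => g0.
(* At the step t = g / q the bound reads 2 g <= g; this step is at most 1 by
   the bound at t = 1. *)
have := step 1 ltr01 (lexx _); rewrite mul1r => gq.
have q_gt0 : 0 < q by lra.
have := step (g / q); rewrite divr_gt0 // ler_pdivrMr // mul1r divfK ?gt_eqF //.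
by move=> /(_ isT); lra.
Qed.

End InnerProduct.

(** * Projection onto a closed convex set *)

Section Projection.
Context (R : realType) (H : completeNormedModType R).
Context (ip : {dot H for @idfun R}) (hip : induces_norm ip).
Implicit Types (x y z p : H) (C : set H).

(** The sets [B e] of points of [C] that minimize the squared distance to [x] up
    to [e] have diameters tending to 0, by the parallelogram law and the
    convexity of [C]. They form a base of a Cauchy filter, whose limit is the
    nearest point. *)
Lemma nearest_point_exists C x : C !=set0 -> closed C -> convex_set C ->
  exists p, C p /\ forall y, C y -> `|p - x| <= `|y - x|.
Proof.
move=> [c Cc] C_closed C_convex.
pose S := [set `|y - x| ^+ 2 | y in C]; pose D := inf S.
have S_inf : has_inf S.
  by split; [exists (`|c - x| ^+ 2), c | exists 0 => _ [y _ <-]; exact: sqr_ge0].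
have D_le y : C y -> D <= `|y - x| ^+ 2.
  by move=> Cy; apply: ge_inf; [case: S_inf | exists y].
pose B e := [set y | C y /\ `|y - x| ^+ 2 < D + e].
pose G := filter_from [set e : R | 0 < e] B.
have G_filter : ProperFilter G.
  apply: filter_from_proper; last first.
    by move=> e /(inf_adherent)/(_ S_inf) [_ [y Cy <-] ye]; exists y.
  apply: filter_from_filter; first by exists 1; exact: ltr01.
  move=> e f e0 f0; exists (Num.min e f); first by rewrite /= lt_min e0.
  move=> y [Cy]; rewrite -ltrBlDl lt_min => /andP[ye yf].
  by split; split => //; rewrite -ltrBlDl.
(* The midpoint of [y] and [z] lies in [C], hence is at squared distance at
   least [D] from [x]. *)
have B_diam e y z : B e y -> B e z -> `|z - y| ^+ 2 < 4 * e.
  move=> [Cy ye] [Cz ze].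
  have half0 : (0 : R) <= 2^-1 by rewrite invr_ge0.
  have half1 : (2^-1 : R) <= 1 by rewrite invf_le1 ?ler1n.
  have := D_le _ (convex_segment C_convex Cy Cz half0 half1).
  have -> : y + 2^-1 *: (z - y) - x = (y - x) + 2^-1 *: (z - y) by rewrite addrAC.
  move: ye ze; have -> : z - x = (y - x) + (z - y).
    by rewrite [RHS]addrC addrA subrK.
  move: (y - x) (z - y) => u v ye.
  rewrite !(sqr_normD hip) linearZr_LR /= normrZ exprMn (ger0_norm half0).
  lra.
have /cauchy_cvgP/cvg_ex[p Gp] : cauchy G.
  apply: cauchy_exP => e e0.
  have e4 : 0 < e ^+ 2 / 4 by rewrite divr_gt0 ?exprn_gt0.
  have [_ [y Cy <-] ye] := inf_adherent e4 S_inf.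
  exists y, (e ^+ 2 / 4) => // z Bz; rewrite -ball_normE /= distrC.
  rewrite -ltr_sqr ?nnegrE ?(ltW e0) //.
  have -> : e ^+ 2 = 4 * (e ^+ 2 / 4) by rewrite mulrC divfK.
  exact: (B_diam _ y z).
have Cp : C p.
  have GC : \forall y \near G, C y by exists 1; [exact: ltr01 | move=> y []].
  exact: (@closed_cvg _ _ G _ id C C_closed GC p Gp).
exists p; split=> // y Cy; rewrite -ler_sqr ?nnegrE //.
apply: le_trans (D_le _ Cy); apply/ler_addgt0Pr => e e0.
have cv : `|z - x| ^+ 2 @[z --> G] --> `|p - x| ^+ 2.
  rewrite expr2; under eq_fun do rewrite expr2.
  have cvB : `|z - x| @[z --> G] --> `|p - x|.
    by apply: cvg_norm; apply: cvgB; [exact: Gp | exact: cvg_cst].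
  exact: cvgM.
have Ge : \forall z \near G, `|z - x| ^+ 2 <= D + e by exists e => // z [_ /ltW].
exact: (closed_cvg [set r | r <= D + e] (@closed_le _ (D + e)) Ge _ cv).
Qed.

End Projection.

Section NearestPoint.
Context (R : realType) (H : completeNormedModType R).
Context (ip : {dot H for @idfun R}) (hip : induces_norm ip).
Context (C : set H) (C_nonempty : C !=set0) (C_closed : closed C).
Context (C_convex : convex_set C).
Implicit Types x y : H.

Lemma projP x : C (proj C x) /\ forall y, C y -> `|proj C x - x| <= `|y - x|.
Proof. exact: (xgetPex 0 (nearest_point_exists hip x C_nonempty C_closed C_convex)). Qed.

Lemma dist_proj x : dist x C = `|x - proj C x|.
Proof.
have [Cp pmin] := projP x.
apply/eqP; rewrite distrC eq_le; apply/andP; split.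
- apply: ge_inf; last by exists (proj C x).
  by exists 0 => _ [y _ <-].
- apply: lb_le_inf; first by exists `|proj C x - x|, (proj C x).
  by move=> _ [y Cy <-]; exact: pmin.
Qed.

End NearestPoint.

(** * Tangent and normal cones *)

Section Cones.
Context (R : realType) (H : normedModType R) (ip : {dot H for @idfun R}).
Context (hip : induces_norm ip).
Implicit Types (u v x y : H) (C : set H).

Lemma sub_tangent_cone C x y : C y -> tangent_cone C x (y - x).
Proof.
move=> Cy; apply: subset_closure; exists 1; first exact: ltr01.
by exists y => //; rewrite invr1 scale1r.
Qed.

(** An inequality <u, y - x> <= 0 survives positive scaling of y - x and
    passage to the limit, so it extends from [C] to the tangent cone. *)
Lemma normal_coneE C x :
  normal_cone ip C x = [set u | forall y, C y -> ip u (y - x) <= 0].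
Proof.
apply/seteqP; split=> u /= u_normal.
  by move=> y Cy; apply/u_normal/sub_tangent_cone.
suff sub : tangent_cone C x `<=` [set v | ip u v <= 0] by exact: sub.
rewrite [X in _ `<=` X](iffLR (closure_id _) (@closed_ip_le _ _ _ hip u 0)).
apply: closureS => _ [l l0 [y Cy <-]] /=.
by rewrite linearZr_LR /= pmulr_rle0 ?invr_gt0 // u_normal.
Qed.

End Cones.

(** * The solution set *)

Section Solutions.
Context (R : realType) (H : normedModType R) (ip : {dot H for @idfun R}).
Context (hip : induces_norm ip) (X : set H) (F : H -> H).
Implicit Types (x y z v : H).

(** Pseudomonotonicity and the two variational inequalities squeeze
    <F y, y - x> to 0, which is the case where pseudomonotonicity+ applies. *)
Lemma vi_solutions_value_unique x y : pseudomonotone_plus ip X F ->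
  vi_solutions ip X F x -> vi_solutions ip X F y -> F x = F y.
Proof.
move=> [F_mono F_plus] [Xx x_sol] [Xy y_sol].
apply: F_plus => //; first exact: x_sol.
apply/eqP; rewrite eq_le F_mono ?x_sol // andbT.
by have := y_sol _ Xx; rewrite -(opprB y) linearNr oppr_ge0.
Qed.

Context (X_convex : convex_set X) (F_continuous : {within X, continuous F}).
Context (F_mono : pseudomonotone ip X F).

(** Minty's lemma. If [s] satisfies <F x, x - s> >= 0 for all x in X, apply this
    at the points s + t (x - s), divide by t and let t tend to 0 from the right:
    continuity of F along the segment gives <F s, x - s> >= 0. *)
Lemma minty : vi_solutions ip X F =
  X `&` \bigcap_(x in X) [set v | ip (F x) v <= ip (F x) x].
Proof.
apply/seteqP; split=> s [Xs s_sol]; split=> // x Xx.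
  by rewrite /= -subr_ge0 -linearBr /=; exact/F_mono/s_sol.
have line : s + t *: (x - s) @[t --> (0 : R)^'+] --> s.
  rewrite -[X in _ --> X]addr0 -(scale0r (x - s)).
  apply: cvgD; first exact: cvg_cst.
  by apply: cvgZl; exact: cvg_within.
have lineX : \forall t \near (0 : R)^'+, X (s + t *: (x - s)).
  near=> t; apply: convex_segment => //.
  by near: t; exact: nbhs_right_le.
have lineF : F (s + t *: (x - s)) @[t --> (0 : R)^'+] --> F s.
  have cF : F z @[z --> within X (nbhs s)] --> F s.
    exact: (iffLR (subspace_continuousP X F) F_continuous).
  apply: (cvg_comp _ _ _ cF) => A A_within; near=> t.
  by apply: (near (line _ A_within) t) => //; near: t.
rewrite ipC.
have line_ge0 : \forall t \near (0 : R)^'+,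
    0 <= ip (x - s) (F (s + t *: (x - s))).
  near=> t; have Xt : X (s + t *: (x - s)) by near: t.
  have t0 : 0 < t by near: t; exact: nbhs_right_gt.
  have := s_sol _ Xt; rewrite /= -subr_ge0 -linearBr /= addrAC subrr add0r.
  by rewrite linearZr_LR /= pmulr_rge0 // ipC.
exact: (closed_cvg _ (@closed_ip_ge _ _ _ hip (x - s) 0) line_ge0 _ lineF).
Unshelve. all: by end_near. Qed.

Lemma closed_vi_solutions : closed X -> closed (vi_solutions ip X F).
Proof.
move=> X_closed; rewrite minty; apply: closedI => //.
by apply: closed_bigI => x _; exact: closed_ip_le.
Qed.

Lemma convex_vi_solutions : convex_set (vi_solutions ip X F).
Proof.
rewrite minty => x y l /set_mem[Xx x_sol] /set_mem[Xy y_sol].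
apply/mem_set; split; first exact: set_mem (X_convex l (mem_set Xx) (mem_set Xy)).
move=> z Xz /=; rewrite linearDr /= !linearZr_LR /=.
rewrite [leRHS](_ : _ = l%:num * ip (F z) z + (1 - l%:num) * ip (F z) z).
  by apply: lerD; apply: ler_wpM2l; rewrite ?subr_ge0 //;
    [exact: x_sol | exact: y_sol].
by rewrite -mulrDl subrKC mul1r.
Qed.

End Solutions.

(** * Weak sharpness *)

(** The claim <c, v> >= alpha |v| says that <k v - c, v> <= 0 for
    k = alpha / |v|; as [v] is tangent to X, it suffices that [k v - c] is normal
    to X at [x]. For y in X split y - x as (y - P y) + (P y - x). On the first
    part, <k v, .> is at most alpha |y - P y| by Cauchy-Schwarz, and this is at
    most <c, y - P y> by the sharpness hypothesis. On the second part
    <k v, .> <= 0 since [v] is normal to C at [x], and <c, .> >= 0 since [x]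
    solves the variational inequality for [c] on C. *)
Lemma tangent_normal_ip_ge (R : realType) (H : normedModType R)
    (ip : {dot H for @idfun R}) (hip : induces_norm ip) (X C : set H)
    (P : H -> H) (alpha : R) (c x v : H) :
  (forall y, X y -> C (P y)) ->
  (forall y, X y -> alpha * `|y - P y| <= ip c (y - P y)) ->
  (forall p, C p -> 0 <= ip c (p - x)) -> 0 <= alpha ->
  tangent_cone X x v -> normal_cone ip C x v -> alpha * `|v| <= ip c v.
Proof.
move=> CP sharp c_ge0 alpha0 v_tangent; rewrite normal_coneE // => v_normal.
have [->|v_neq0] := eqVneq v 0; first by rewrite normr0 mulr0 linear0r.
have v_gt0 : 0 < `|v| by rewrite normr_gt0.
pose k := alpha / `|v|.
have k_ge0 : 0 <= k by rewrite divr_ge0 // ltW.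
suff : normal_cone ip X x (k *: v - c).
  move=> /(_ v v_tangent); rewrite linearBl /= linearZl_LR /= hip subr_le0.
  by rewrite expr2 mulrA divfK ?gt_eqF.
rewrite normal_coneE // => y Xy; rewrite linearBl /= linearZl_LR /= subr_le0.
have -> : y - x = (y - P y) + (P y - x) by rewrite addrA subrK.
rewrite (linearDr ip v) (linearDr ip c) /= mulrDr; apply: lerD; last first.
  apply: le_trans (c_ge0 _ (CP _ Xy)).
  by rewrite mulr_ge0_le0 // v_normal //; exact: CP.
apply: le_trans (sharp _ Xy).
apply: le_trans (ler_wpM2l k_ge0 (ip_le_norm hip v _)) _.
by rewrite mulrA divfK ?gt_eqF.
Qed.

Theorem theorem3p1 (R : realType) (H : completeNormedModType R)
    (ip : {dot H for @idfun R}) (hip : induces_norm ip)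
    (X : set H) (F : H -> H)
    (X_nonempty : X !=set0) (X_closed : closed X) (X_convex : convex_set X)
    (F_continuous : {within X, continuous F})
    (F_pseudomonotone_plus : pseudomonotone_plus ip X F)
    (solutions_nonempty : vi_solutions ip X F !=set0) :
  weakly_sharp ip X F <->
  exists alpha : R, 0 < alpha /\
    forall x : H, X x ->
      let p := proj (vi_solutions ip X F) x in
      alpha * dist x (vi_solutions ip X F) <= ip (F p) (x - p).
Proof.
have F_mono := F_pseudomonotone_plus.1.
have Xs_closed := closed_vi_solutions hip X_convex F_continuous F_mono X_closed.
have Xs_convex := convex_vi_solutions hip X_convex F_continuous F_mono.
have F_cst := vi_solutions_value_unique F_pseudomonotone_plus.
have projE := projP hip solutions_nonempty Xs_closed Xs_convex.
have distE := dist_proj hip solutions_nonempty Xs_closed Xs_convex.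
rewrite /weakly_sharp /=; set Xs := vi_solutions ip X F in Xs_closed *.
split=> [sharp|[alpha [alpha0 sharp]] s Xs_s].
- have [s Xs_s] := solutions_nonempty.
  have /nbhs_normP[r /= r0 ball_r] := sharp s Xs_s.
  exists (r / 2); split; first by rewrite divr_gt0.
  move=> x Xx; rewrite distE; set p := proj Xs x; set d := x - p.
  have [Xs_p p_min] := projE x.
  have [->|d_neq0] := eqVneq d 0; first by rewrite normr0 mulr0 linear0r.
  have d_gt0 : 0 < `|d| by rewrite normr_gt0.
  pose k := r / 2 / `|d|.
  have k_ge0 : 0 <= k by rewrite !divr_ge0 // ltW.
  (* The vector - F p + k d lies at distance r / 2 from - F p. *)
  have : polar ip (tangent_cone X p `&` normal_cone ip Xs p) (- F p + k *: d).
    apply: ball_r => //=.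
    rewrite (F_cst _ _ Xs_s Xs_p) opprD addrA subrr add0r normrN normrZ.
    by rewrite ger0_norm // divfK ?gt_eqF // gtr_pMr // invf_lt1 ?ltr1n.
  move=> /(_ d); rewrite linearDl /= linearNl /= linearZl_LR /= hip.
  rewrite addrC subr_le0 expr2 mulrA divfK ?gt_eqF //; apply; split.
    exact: sub_tangent_cone.
  rewrite normal_coneE // => y Xs_y.
  exact: (nearest_point_ip_le hip Xs_convex Xs_p p_min Xs_y).
- apply/nbhs_normP; exists alpha => //= w /ltW w_near x Xs_x v [v_tan v_nor].
  have Fx_ge : alpha * `|v| <= ip (F x) v.
    apply: (tangent_normal_ip_ge hip (C := Xs) (P := proj Xs) _ _ _
      (ltW alpha0) v_tan v_nor).
    + by move=> y _; have [] := projE y.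
    + move=> y Xy; have [Xs_p _] := projE y.
      by rewrite (F_cst _ _ Xs_x Xs_p) -distE; exact: sharp.
    + by move=> p [Xp _]; exact: Xs_x.2.
  (* The displacement of w from - F s is shorter than alpha, so it changes the
     pairing with v by at most alpha |v|. *)
  have -> : w = - F x - (- F s - w).
    by rewrite (F_cst _ _ Xs_s Xs_x) opprB addrC subrK.
  rewrite linearBl /= linearNl /= -opprD oppr_le0 -[ip (_ - w) v]opprK -linearNl /=.
  rewrite subr_ge0; apply: le_trans (ip_le_norm hip _ _) _; rewrite normrN.
  by apply: le_trans Fx_ge; exact: ler_wpM2r.
Qed.
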